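(* The following hold by choice-free constructions (no axiom of choice, and no excluded middle, limited principle of omniscience, or Markov's principle). (a) The carriers $\mathbb{N}_\delta$, $\mathbb{Z}_\delta$, $\mathbb{Q}_\delta$ are constructed from the generated $\delta$-orbit: $\mathbb{N}_\delta$ is the natural-number object presented by this orbit; $\mathbb{Z}_\delta$ is the group completion of $\mathbb{N}_\delta$ (with canonical map $a\mapsto[(a,0)]$); and $\mathbb{Q}_\delta$, presented by ratio orbits with signed-orbit numerators, is the field of fractions of $\mathbb{Z}_\delta$ (with canonical map $[(p,n)]\mapsto[((p,n),1)]$). (b) The metatheoretic number systems $\mathbb{N}$, $\mathbb{Z}$ and $\mathbb{Q}$ are $\delta$-encodable.
   Context: The ambient metatheory is intuitionistic type theory with inductive types and quotients by equivalence relations. $\mathbb{N}_\delta$ (the $\delta$-orbit) is the inductively generated type with constructors $0$ and $r\mapsto Sr$. Addition and multiplication are defined by $x+0=x$, $x+Sy=S(x+y)$, $x\cdot 0=0$, $x\cdot Sy=x\cdot y+x$, and $1:=S0$. A signed orbit is a pair $(p,n)\in\mathbb{N}_\delta\times\mathbb{N}_\delta$. Two signed orbits are balanced, $(p,n)\sim(p',n')$, if $p+n'=p'+n$. On signed orbits put $(p,n)+(p',n')=(p+p',n+n')$, $(p,n)\cdot(p',n')=(p\cdot p'+n\cdot n',\,p\cdot n'+n\cdot p')$ and $-(p,n)=(n,p)$. The object $\mathbb{Z}_\delta:=(\mathbb{N}_\delta\times\mathbb{N}_\delta)/{\sim}$ carries the induced addition, multiplication and negation, with $0=[(0,0)]$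 and $1=[(1,0)]$. A ratio orbit is a pair $(u,d)$ with $u$ a signed orbit and $d\in\mathbb{N}_\delta$, $d\ne0$; an element $d\in\mathbb{N}_\delta$ is identified with the signed orbit $(d,0)$. Ratio orbits $(u,d)$ and $(u',d')$ are cross-equal, $(u,d)\approx(u',d')$, if $u\cdot d'\sim u'\cdot d$. The object $\mathbb{Q}_\delta$ is the quotient of the ratio orbits by $\approx$, with operations induced by $(u,d)+(u',d')=(u\cdot d'+u'\cdot d,\,d\cdot d')$, $(u,d)\cdot(u',d')=(u\cdot u',\,d\cdot d')$, $-(u,d)=(-u,d)$, zero $[((0,0),1)]$ and unit $[((1,0),1)]$. A carrier $X$ is $\delta$-encodable if there exists an injection $X\hookrightarrow\mathbb{N}_\delta$. *)

(* Defs.v *)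
From HB Require Import structures.
From mathcomp Require Import all_boot all_order all_algebra.
Set Implicit Arguments.
Unset Strict Implicit.
Unset Printing Implicit Defensive.

(* Algebraic structures are stated as axioms on raw operations over an
   arbitrary [Type]: the MathComp structures carry a choice operator and a
   decidable equality, so that quantifying over them would restrict the
   universal properties below to carriers equipped with choice.  Existence
   claims are informative ([{x | P x}] in [Type]), i.e. constructions, and
   functions are compared pointwise ([=1]). *)

Definition unique_fun (A B : Type) (P : (A -> B) -> Prop) : Type :=
  {h : A -> B | P h & forall h', P h' -> h' =1 h}.

Definition is_nno (N : Type) (z : N) (s : N -> N) : Type :=
  forall (X : Type) (x : X) (f : X -> X),
    unique_fun (fun h : N -> X => h z = x /\ forall n, h (s n) = f (h n)).

Record is_comm_monoid (M : Type) (e : M) (op : M -> M -> M) : Prop := {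
  cm_assoc : associative op;
  cm_comm : commutative op;
  cm_id : left_id e op
}.

Record is_group (G : Type) (e : G) (op : G -> G -> G) (inv : G -> G) : Prop := {
  grp_assoc : associative op;
  grp_id : left_id e op;
  grp_inv : left_inverse e inv op
}.

Record is_monoid_hom (M H : Type) (eM : M) (opM : M -> M -> M)
    (eH : H) (opH : H -> H -> H) (f : M -> H) : Prop := {
  mh_id : f eM = eH;
  mh_op : {morph f : x y / opM x y >-> opH x y}
}.

(* The target [H] ranges over all groups, commutative or not; a monoid
   homomorphism between groups is a group homomorphism. *)
Record is_group_completion (M : Type) (eM : M) (opM : M -> M -> M)
    (G : Type) (eG : G) (opG : G -> G -> G) (invG : G -> G)
    (iota : M -> G) : Type := {
  gc_monoid : is_comm_monoid eM opM;
  gc_group : is_group eG opG invG;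
  gc_comm : commutative opG;
  gc_hom : is_monoid_hom eM opM eG opG iota;
  gc_univ : forall (H : Type) (eH : H) (opH : H -> H -> H) (invH : H -> H),
    is_group eH opH invH ->
    forall f : M -> H, is_monoid_hom eM opM eH opH f ->
    unique_fun (fun h : G -> H =>
      is_monoid_hom eG opG eH opH h /\ forall a, h (iota a) = f a)
}.

Record ring_ops (R : Type) : Type := RingOps {
  op_zero : R;
  op_one : R;
  op_add : R -> R -> R;
  op_mul : R -> R -> R;
  op_opp : R -> R
}.

Record is_comring (R : Type) (o : ring_ops R) : Prop := {
  cr_addA : associative (op_add o);
  cr_addC : commutative (op_add o);
  cr_add0 : left_id (op_zero o) (op_add o);
  cr_addN : left_inverse (op_zero o) (op_opp o) (op_add o);
  cr_mulA : associative (op_mul o);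
  cr_mulC : commutative (op_mul o);
  cr_mul1 : left_id (op_one o) (op_mul o);
  cr_mulD : left_distributive (op_mul o) (op_add o)
}.

Record is_domain (R : Type) (o : ring_ops R) : Prop := {
  dom_ring : is_comring o;
  dom_nontrivial : op_one o <> op_zero o;
  dom_integral : forall x y,
    op_mul o x y = op_zero o -> x = op_zero o \/ y = op_zero o
}.

Record is_field (K : Type) (o : ring_ops K) : Type := {
  fld_ring : is_comring o;
  fld_nontrivial : op_one o <> op_zero o;
  fld_inv : forall x, x <> op_zero o -> {y : K | op_mul o x y = op_one o}
}.

Record is_ring_hom (R S : Type) (oR : ring_ops R) (oS : ring_ops S)
    (f : R -> S) : Prop := {
  rh_one : f (op_one oR) = op_one oS;
  rh_add : {morph f : x y / op_add oR x y >-> op_add oS x y};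
  rh_mul : {morph f : x y / op_mul oR x y >-> op_mul oS x y}
}.

Record is_fraction_field (R : Type) (oR : ring_ops R)
    (K : Type) (oK : ring_ops K) (iota : R -> K) : Type := {
  ff_domain : is_domain oR;
  ff_field : is_field oK;
  ff_hom : is_ring_hom oR oK iota;
  ff_inj : injective iota;
  ff_frac : forall q : K, {ab : R * R |
    ab.2 <> op_zero oR /\ op_mul oK q (iota ab.2) = iota ab.1};
  ff_univ : forall (F : Type) (oF : ring_ops F), is_field oF ->
    forall f : R -> F, is_ring_hom oR oF f -> injective f ->
    unique_fun (fun h : K -> F =>
      is_ring_hom oK oF h /\ forall a, h (iota a) = f a)
}.

Inductive Nd : Type := Nd0 | NdS (r : Nd).

Definition Nd1 : Nd := NdS Nd0.

Fixpoint nadd (x y : Nd) : Nd :=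
  if y is NdS y' then NdS (nadd x y') else x.

Fixpoint nmul (x y : Nd) : Nd :=
  if y is NdS y' then nadd (nmul x y') x else Nd0.

(* Decidable equality and enumeration of [Nd], read off from [nat]; the choice
   operator that comes with them, which picks canonical representatives in the
   quotients below, is a terminating search and not an axiom. *)
Fixpoint nat_of_Nd (x : Nd) : nat := if x is NdS x' then (nat_of_Nd x').+1 else 0.
Fixpoint Nd_of_nat (n : nat) : Nd := if n is n'.+1 then NdS (Nd_of_nat n') else Nd0.

Lemma nat_of_NdK : cancel nat_of_Nd Nd_of_nat.
Proof. by elim=> //= x ->. Qed.

HB.instance Definition _ := Countable.copy Nd (can_type nat_of_NdK).

Lemma nat_of_Nd_inj : injective nat_of_Nd.
Proof. exact: can_inj nat_of_NdK. Qed.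

Lemma nat_of_naddE x y : nat_of_Nd (nadd x y) = (nat_of_Nd x + nat_of_Nd y)%N.
Proof. by elim: y => [|y IH] /=; rewrite ?addn0 // IH addnS. Qed.

Lemma nat_of_nmulE x y : nat_of_Nd (nmul x y) = (nat_of_Nd x * nat_of_Nd y)%N.
Proof. by elim: y => [|y IH] /=; rewrite ?muln0 // nat_of_naddE IH mulnS addnC. Qed.

Definition signed_orbit : Type := (Nd * Nd)%type.

Definition balanced (u v : signed_orbit) : bool := nadd u.1 v.2 == nadd v.1 u.2.

Definition sadd (u v : signed_orbit) : signed_orbit := (nadd u.1 v.1, nadd u.2 v.2).
Definition smul (u v : signed_orbit) : signed_orbit :=
  (nadd (nmul u.1 v.1) (nmul u.2 v.2), nadd (nmul u.1 v.2) (nmul u.2 v.1)).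
Definition sopp (u : signed_orbit) : signed_orbit := (u.2, u.1).
Definition signed_of (d : Nd) : signed_orbit := (d, Nd0).

Section SignedValue.
Import GRing.Theory Num.Theory.
Local Open Scope ring_scope.

Definition int_of_signed (u : signed_orbit) : int :=
  (nat_of_Nd u.1)%:Z - (nat_of_Nd u.2)%:Z.

Lemma balancedE u v : balanced u v = (int_of_signed u == int_of_signed v).
Proof.
rewrite /balanced -(inj_eq nat_of_Nd_inj) !nat_of_naddE /int_of_signed.
by rewrite subr_eq addrAC eq_sym -subr_eq opprK eq_sym -!PoszD.
Qed.

Lemma int_of_smul_signed_of u d :
  int_of_signed (smul u (signed_of d)) = int_of_signed u * (nat_of_Nd d)%:Z.
Proof.
by rewrite /int_of_signed /= nat_of_naddE !nat_of_nmulE add0n !PoszM mulrBl.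
Qed.
End SignedValue.

Lemma balanced_refl : reflexive balanced.
Proof. by move=> u; rewrite balancedE. Qed.
Lemma balanced_sym : symmetric balanced.
Proof. by move=> u v; rewrite !balancedE eq_sym. Qed.
Lemma balanced_trans : transitive balanced.
Proof. by move=> v u w; rewrite !balancedE => /eqP-> /eqP->. Qed.

Canonical balanced_equiv :=
  EquivRel balanced balanced_refl balanced_sym balanced_trans.

Definition Zd : Type := {eq_quot balanced}%qT.
HB.instance Definition _ : EqQuotient _ balanced Zd := EqQuotient.on Zd.
HB.instance Definition _ := Choice.on Zd.

Definition classZ (u : signed_orbit) : Zd := (\pi_Zd u)%qT.

(* [lift_op1], [lift_op2] act on canonical representatives; [induced_Z] and
   [induced_Q] below say that they are the induced operations. *)
Definition zero_Z : Zd := classZ (Nd0, Nd0).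
Definition one_Z : Zd := classZ (Nd1, Nd0).
Definition add_Z : Zd -> Zd -> Zd := lift_op2 Zd sadd.
Definition mul_Z : Zd -> Zd -> Zd := lift_op2 Zd smul.
Definition opp_Z : Zd -> Zd := lift_op1 Zd sopp.
Definition Zd_ops : ring_ops Zd := RingOps zero_Z one_Z add_Z mul_Z opp_Z.

Definition ratio_orbit : Type := {r : signed_orbit * Nd | r.2 != Nd0}.

Definition num (r : ratio_orbit) : signed_orbit := (val r).1.
Definition den (r : ratio_orbit) : Nd := (val r).2.

Definition mk_ratio (u : signed_orbit) (d : Nd) (hd : d != Nd0) : ratio_orbit :=
  exist (fun r : signed_orbit * Nd => r.2 != Nd0) (u, d) hd.

Lemma den_neq0 (r : ratio_orbit) : den r != Nd0.
Proof. exact: valP r. Qed.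

Lemma nmul_neq0 d d' : d != Nd0 -> d' != Nd0 -> nmul d d' != Nd0.
Proof.
rewrite -!(inj_eq nat_of_Nd_inj) nat_of_nmulE /= muln_eq0.
by move=> /negPf-> /negPf->.
Qed.

Lemma Nd1_neq0 : Nd1 != Nd0. Proof. by []. Qed.

Definition cross_equal (r r' : ratio_orbit) : bool :=
  balanced (smul (num r) (signed_of (den r'))) (smul (num r') (signed_of (den r))).

Definition radd (r r' : ratio_orbit) : ratio_orbit :=
  mk_ratio (sadd (smul (num r) (signed_of (den r')))
                 (smul (num r') (signed_of (den r))))
           (nmul_neq0 (den_neq0 r) (den_neq0 r')).
Definition rmul (r r' : ratio_orbit) : ratio_orbit :=
  mk_ratio (smul (num r) (num r')) (nmul_neq0 (den_neq0 r) (den_neq0 r')).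
Definition ropp (r : ratio_orbit) : ratio_orbit := mk_ratio (sopp (num r)) (den_neq0 r).

Section CrossEqual.
Import GRing.Theory Num.Theory.
Local Open Scope ring_scope.

Lemma cross_equalE r r' :
  cross_equal r r' = (int_of_signed (num r) * (nat_of_Nd (den r'))%:Z
                      == int_of_signed (num r') * (nat_of_Nd (den r))%:Z).
Proof. by rewrite /cross_equal balancedE !int_of_smul_signed_of. Qed.

Lemma cross_equal_refl : reflexive cross_equal.
Proof. by move=> r; rewrite cross_equalE. Qed.
Lemma cross_equal_sym : symmetric cross_equal.
Proof. by move=> r r'; rewrite !cross_equalE eq_sym. Qed.
Lemma cross_equal_trans : transitive cross_equal.
Proof.
move=> s r t; rewrite !cross_equalE => /eqP Hrs /eqP Hst.
have Ds : (nat_of_Nd (den s))%:Z != 0.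
  by have := den_neq0 s; rewrite -(inj_eq nat_of_Nd_inj).
apply/eqP/(mulIf Ds).
by rewrite mulrAC Hrs mulrAC Hst mulrAC.
Qed.
End CrossEqual.

Canonical cross_equal_equiv :=
  EquivRel cross_equal cross_equal_refl cross_equal_sym cross_equal_trans.

Definition Qd : Type := {eq_quot cross_equal}%qT.
HB.instance Definition _ : EqQuotient _ cross_equal Qd := EqQuotient.on Qd.
HB.instance Definition _ := Choice.on Qd.

Definition classQ (r : ratio_orbit) : Qd := (\pi_Qd r)%qT.

Definition zero_Q : Qd := classQ (mk_ratio (Nd0, Nd0) Nd1_neq0).
Definition one_Q : Qd := classQ (mk_ratio (Nd1, Nd0) Nd1_neq0).
Definition add_Q : Qd -> Qd -> Qd := lift_op2 Qd radd.
Definition mul_Q : Qd -> Qd -> Qd := lift_op2 Qd rmul.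
Definition opp_Q : Qd -> Qd := lift_op1 Qd ropp.
Definition Qd_ops : ring_ops Qd := RingOps zero_Q one_Q add_Q mul_Q opp_Q.

Definition Nd_to_Zd (a : Nd) : Zd := classZ (a, Nd0).
Definition Zd_to_Qd (z : Zd) : Qd := classQ (mk_ratio (repr z) Nd1_neq0).

Record induced_Z : Prop := {
  induced_Z_add : {morph classZ : u v / sadd u v >-> add_Z u v};
  induced_Z_mul : {morph classZ : u v / smul u v >-> mul_Z u v};
  induced_Z_opp : {morph classZ : u / sopp u >-> opp_Z u}
}.

Record induced_Q : Prop := {
  induced_Q_add : {morph classQ : r s / radd r s >-> add_Q r s};
  induced_Q_mul : {morph classQ : r s / rmul r s >-> mul_Q r s};
  induced_Q_opp : {morph classQ : r / ropp r >-> opp_Q r};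
  induced_Q_of_Z : forall u : signed_orbit,
    Zd_to_Qd (classZ u) = classQ (mk_ratio u Nd1_neq0)
}.

Definition delta_encodable (X : Type) : Type := {f : X -> Nd | injective f}.

(* Main.v *)
Require Import Defs.
From mathcomp Require Import all_boot all_order all_algebra.
Import GRing.Theory.

Set Implicit Arguments.
Unset Strict Implicit.
Unset Printing Implicit Defensive.

(** Every carrier has a value in a known number system: a signed orbit
    [(p, n)] is worth the integer [p - n], and a ratio orbit [(u, d)] is worth
    the rational [u / d].  The relations [balanced] and [cross_equal] say
    exactly that two values agree, so the values descend to injections
    [int_of_Zd] and [rat_of_Qd] of the quotients, and these carry the induced
    operations to those of [int] and [rat].  Hence each equational law,
    integrality and cancellation is read off from [int] or [rat]
    ([comring_of_embedding]).  Inverses in [Qd] are also obtained in this way: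
    [rat_of_Qd] has an explicit section [Qd_of_rat].

    The two universal properties are proved for arbitrary carriers.  If each
    [z] in [G] is presented as a difference of elements of a commutative monoid
    that embeds in [G], a homomorphism [f] into a group extends to [G] in only
    one way, because [z + iota n = iota p] forces [h z = f p * (f n)^-1]; that
    this value does not depend on the presentation, and respects the operation,
    follows by cancelling in the target ([group_completion_of_differences]).
    The same argument with fractions in place of differences gives the
    universal property of the field of fractions
    ([fraction_field_of_fractions]).  No choice is made in either case: the
    presentation [(p, n)] or [(a, b)] comes as data, as does the inverse in the
    target field.

    The number systems [nat], [int] and [rat] are encodable because each has an
    explicit injection into [nat], of which the orbit is a copy. *)

(** * The orbit as a natural-number object *)

Lemma Nd_is_nno : is_nno Nd0 NdS.
Proof.
move=> X x f.
exists (fix h n := if n is NdS n' then f (h n') else x) => //.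
by move=> h' [h0 hS]; elim=> [|n IHn]; rewrite ?h0 // hS IHn.
Qed.

Lemma Nd_of_natK : cancel Nd_of_nat nat_of_Nd.
Proof. by elim=> //= n ->. Qed.

Lemma delta_encodable_countable (T : countType) : delta_encodable T.
Proof.
exists (Nd_of_nat \o @pickle T).
by apply: inj_comp; [apply: can_inj Nd_of_natK | apply: pcan_inj pickleK].
Qed.

Lemma Nd_comm_monoid : is_comm_monoid Nd0 nadd.
Proof.
split=> [x y z | x y | x]; apply: nat_of_Nd_inj; rewrite !nat_of_naddE.
- by rewrite addnA.
- by rewrite addnC.
- by rewrite add0n.
Qed.

(** * Groups of differences *)

Section GroupTheory.
Variables (G : Type) (e : G) (op : G -> G -> G) (inv : G -> G).
Hypothesis grpG : is_group e op inv.

(** With only left-sided axioms, [x * x^-1] is idempotent, hence trivial. *)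
Lemma group_mulV : right_inverse e inv op.
Proof.
case: grpG => mA m1 mV x; set u := op x (inv x).
have uu : op u u = u by rewrite /u mA -(mA x) mV -mA m1.
by rewrite -[LHS]m1 -(mV u) -mA uu.
Qed.

Lemma group_mul1 : right_id e op.
Proof. by case: (grpG) => mA m1 mV x; rewrite -(mV x) mA group_mulV m1. Qed.

Lemma group_mulVK x y : op (op x (inv y)) y = x.
Proof. by case: (grpG) => mA m1 mV; rewrite -mA mV group_mul1. Qed.

Lemma group_mulK x y : op (op x y) (inv y) = x.
Proof. by case: (grpG) => mA m1 mV; rewrite -mA group_mulV group_mul1. Qed.

Lemma group_mulIg x y z : op y x = op z x -> y = z.
Proof. by move=> eq_yz; rewrite -(group_mulK y x) eq_yz group_mulK. Qed.

End GroupTheory.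

Section Differences.
Variables (M : Type) (eM : M) (opM : M -> M -> M).
Variables (G : Type) (eG : G) (opG : G -> G -> G) (invG : G -> G).
Variable iota : M -> G.
Hypotheses (monM : is_comm_monoid eM opM) (grpG : is_group eG opG invG).
Hypotheses (opGC : commutative opG) (homi : is_monoid_hom eM opM eG opG iota).
Hypothesis iota_inj : injective iota.
Hypothesis diffG : forall z, {pn : M * M | opG z (iota pn.2) = iota pn.1}.

Section Extension.
Variables (H : Type) (eH : H) (opH : H -> H -> H) (invH : H -> H).
Hypothesis grpH : is_group eH opH invH.
Variable f : M -> H.
Hypothesis homf : is_monoid_hom eM opM eH opH f.

Definition difference_ext (z : G) : H :=
  opH (f (sval (diffG z)).1) (invH (f (sval (diffG z)).2)).

(** The target may be a non-commutative group; commuting the images of elements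
    of [M] is what makes every cancellation below possible in it. *)
Lemma image_comm x y : opH (f x) (f y) = opH (f y) (f x).
Proof. by rewrite -!(mh_op homf) (cm_comm monM). Qed.

(** The extension agrees with every presentation of [z], not just with the one
    that defines it: two presentations satisfy [p0 + n = p + n0] in [M], since
    [iota] is injective. *)
Lemma difference_extE z p n :
  opG z (iota n) = iota p -> opH (difference_ext z) (f n) = f p.
Proof.
have GA := grp_assoc grpG; have HA := grp_assoc grpH => z_pn.
rewrite /difference_ext; case: (diffG z) => -[p0 n0] /= z_pn0.
have eqM : opM p0 n = opM p n0.
  apply: iota_inj; rewrite !(mh_op homi) -z_pn0 -z_pn -!GA.
  by rewrite [opG (iota n0) _]opGC.
apply: (group_mulIg grpH (x := f n0)).
by rewrite -HA image_comm HA (group_mulVK grpH) -!(mh_op homf) eqM.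
Qed.

Lemma difference_ext_iota a : difference_ext (iota a) = f a.
Proof.
rewrite -(@difference_extE (iota a) a eM); last first.
  by rewrite (mh_id homi) opGC (grp_id grpG).
by rewrite (mh_id homf) (group_mul1 grpH).
Qed.

(** If [z = p - n] and [w = p' - n'], then [z * w] is presented by [p + p'] and
    [n' + n]; in this order [f n'] meets [difference_ext w] first, and [f p'] is
    then moved past [f n], both being images of elements of [M]. *)
Lemma difference_ext_hom : is_monoid_hom eG opG eH opH difference_ext.
Proof.
have GA := grp_assoc grpG; have HA := grp_assoc grpH.
split=> [|z w]; first by rewrite -(mh_id homi) difference_ext_iota (mh_id homf).
case: (diffG z) => -[p n] /= z_pn; case: (diffG w) => -[p' n'] /= w_pn.
have zw_pn : opG (opG z w) (iota (opM n' n)) = iota (opM p p').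
  rewrite !(mh_op homi) -z_pn -w_pn -!GA; congr (opG z _).
  by rewrite [RHS]opGC !GA.
have := difference_extE zw_pn; rewrite !(mh_op homf) => hzw.
apply: (group_mulIg grpH (x := opH (f n') (f n))); rewrite hzw.
rewrite -(HA (difference_ext z)) (HA (difference_ext w)) (difference_extE w_pn).
rewrite (image_comm p' n) HA.
by rewrite (difference_extE z_pn).
Qed.

End Extension.

Lemma group_completion_of_differences :
  is_group_completion eM opM eG opG invG iota.
Proof.
split=> // H eH opH invH grpH f homf.
exists (difference_ext opH invH f).
  split; first exact: (difference_ext_hom grpH homf).
  exact: (difference_ext_iota grpH homf).
move=> h' [homh' h'i] z; case: (diffG z) => -[p n] /= z_pn.
apply: (group_mulIg grpH (x := f n)).
rewrite (difference_extE grpH homf z_pn).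
by rewrite -h'i -(mh_op homh') z_pn h'i.
Qed.

End Differences.

(** * Fields of fractions *)

Section CommutativeRings.
Variables (R : Type) (o : ring_ops R).
Hypothesis ringR : is_comring o.
Local Notation "0" := (op_zero o).
Local Notation "x + y" := (op_add o x y).
Local Notation "x * y" := (op_mul o x y).

Lemma comring_mulAC x y z : (x * y) * z = (x * z) * y.
Proof. by rewrite -!(cr_mulA ringR) (cr_mulC ringR y). Qed.

Lemma comring_mulACA x y z t : (x * y) * (z * t) = (x * z) * (y * t).
Proof. by rewrite !(cr_mulA ringR) (comring_mulAC x y z). Qed.

Lemma comring_addxx x : x + x = x -> x = 0.
Proof.
move=> xx; rewrite -[LHS](cr_add0 ringR) -[X in X + _](cr_addN ringR x).
by rewrite -(cr_addA ringR) xx (cr_addN ringR).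
Qed.

End CommutativeRings.

Lemma ring_hom0 (R S : Type) (oR : ring_ops R) (oS : ring_ops S) (f : R -> S) :
  is_comring oR -> is_comring oS -> is_ring_hom oR oS f ->
  f (op_zero oR) = op_zero oS.
Proof.
move=> ringR ringS homf; apply: (comring_addxx ringS).
by rewrite -(rh_add homf) (cr_add0 ringR).
Qed.

Lemma field_mulIf (F : Type) (o : ring_ops F) (x y z : F) :
  is_field o -> x <> op_zero o -> op_mul o y x = op_mul o z x -> y = z.
Proof.
move=> fldF nz_x eq_yz; have ringF := fld_ring fldF.
have [x' xx'] := fld_inv fldF nz_x.
rewrite -[LHS](cr_mul1 ringF) -[RHS](cr_mul1 ringF) -xx'.
by rewrite !(cr_mulC ringF (op_mul o x x')) !(cr_mulA ringF) eq_yz.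
Qed.

Section Fractions.
Variables (R : Type) (oR : ring_ops R) (K : Type) (oK : ring_ops K).
Variable iota : R -> K.
Hypotheses (domR : is_domain oR) (fldK : is_field oK).
Hypotheses (homi : is_ring_hom oR oK iota) (iota_inj : injective iota).
Hypothesis fracK : forall q : K, {ab : R * R |
  ab.2 <> op_zero oR /\ op_mul oK q (iota ab.2) = iota ab.1}.

Section Extension.
Variables (F : Type) (oF : ring_ops F).
Hypothesis fldF : is_field oF.
Variable f : R -> F.
Hypotheses (homf : is_ring_hom oR oF f) (f_inj : injective f).

Let ringR := dom_ring domR.
Let ringK := fld_ring fldK.
Let ringF := fld_ring fldF.

(** Injectivity of [f] makes the images of denominators invertible in [F]. *)
Lemma image_neq0 b : b <> op_zero oR -> f b <> op_zero oF.
Proof.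
by move=> nz_b fb0; apply/nz_b/f_inj; rewrite fb0 (ring_hom0 ringR ringF homf).
Qed.

Definition fraction_ext (q : K) : F :=
  let (ab, frac_q) := fracK q in
  op_mul oF (f ab.1) (sval (fld_inv fldF (image_neq0 (proj1 frac_q)))).

(** As for differences: two presentations [a0 / b0] and [a / b] of [q] satisfy
    [a0 * b = a * b0] in [R], since [iota] is injective. *)
Lemma fraction_extE q a b :
  op_mul oK q (iota b) = iota a -> op_mul oF (fraction_ext q) (f b) = f a.
Proof.
move=> q_ab; rewrite /fraction_ext; case: (fracK q) => -[a0 b0] /= [nz_b0 q_ab0].
case: (fld_inv _ _) => y /= b0y.
have eqR : op_mul oR a0 b = op_mul oR a b0.
  by apply: iota_inj; rewrite !(rh_mul homi) -q_ab0 -q_ab comring_mulAC.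
apply: (field_mulIf fldF (image_neq0 nz_b0)).
rewrite (comring_mulAC ringF) -(cr_mulA ringF (f a0)) (cr_mulC ringF y) b0y.
by rewrite (cr_mulC ringF (f a0)) (cr_mul1 ringF) -!(rh_mul homf) eqR.
Qed.

Lemma fraction_ext_iota a : fraction_ext (iota a) = f a.
Proof.
rewrite -(@fraction_extE (iota a) a (op_one oR)).
  by rewrite (rh_one homf) (cr_mulC ringF) (cr_mul1 ringF).
by rewrite (rh_one homi) (cr_mulC ringK) (cr_mul1 ringK).
Qed.

(** Sums and products of fractions are presented by [(a d + c b) / (b d)] and
    [(a c) / (b d)]; the two denominators are then cancelled in [F]. *)
Lemma fraction_ext_hom : is_ring_hom oK oF fraction_ext.
Proof.
split; first by rewrite -(rh_one homi) fraction_ext_iota (rh_one homf).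
- move=> q r.
  case: (fracK q) => -[a b] /= [nz_b q_ab]; case: (fracK r) => -[c d] /= [nz_d r_cd].
  apply: (field_mulIf fldF (image_neq0 nz_b)).
  apply: (field_mulIf fldF (image_neq0 nz_d)).
  rewrite -(cr_mulA ringF) -(rh_mul homf).
  rewrite (@fraction_extE _ (op_add oR (op_mul oR a d) (op_mul oR c b))).
    rewrite !(cr_mulD ringF) (fraction_extE q_ab).
    rewrite (comring_mulAC ringF (fraction_ext r)) (fraction_extE r_cd).
    by rewrite (rh_add homf) !(rh_mul homf).
  rewrite (rh_add homi) !(rh_mul homi) -q_ab -r_cd (cr_mulA ringK).
  by rewrite !(cr_mulD ringK) (comring_mulAC ringK r).
- move=> q r.
  case: (fracK q) => -[a b] /= [nz_b q_ab]; case: (fracK r) => -[c d] /= [nz_d r_cd].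
  apply: (field_mulIf fldF (image_neq0 nz_b)).
  apply: (field_mulIf fldF (image_neq0 nz_d)).
  rewrite -!(cr_mulA ringF _ (f b)) -(rh_mul homf).
  rewrite (@fraction_extE _ (op_mul oR a c)); last first.
    by rewrite !(rh_mul homi) -q_ab -r_cd (comring_mulACA ringK).
  rewrite !(rh_mul homf) (comring_mulACA ringF).
  by rewrite (fraction_extE q_ab) (fraction_extE r_cd).
Qed.

End Extension.

Lemma fraction_field_of_fractions : is_fraction_field oR oK iota.
Proof.
split=> // F oF fldF f homf f_inj.
exists (fraction_ext fldF homf f_inj).
  split; first exact: fraction_ext_hom.
  by move=> a; apply: fraction_ext_iota.
move=> h' [homh' h'i] q; case: (fracK q) => -[a b] /= [nz_b q_ab].
apply: (field_mulIf fldF (image_neq0 fldF homf f_inj nz_b)).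
rewrite (fraction_extE fldF homf f_inj q_ab).
by rewrite -h'i -(rh_mul homh') q_ab h'i.
Qed.

End Fractions.

(** * Integer values, and the completion of the orbit *)

Section Values.
Local Open Scope ring_scope.

(** An equation between ring expressions holds as soon as its image under an
    injective map that respects the operations does. *)
Lemma comring_of_embedding (R : Type) (o : ring_ops R) (S : comNzRingType)
    (v : R -> S) :
  injective v -> v (op_zero o) = 0 -> v (op_one o) = 1 ->
  {morph v : x y / op_add o x y >-> x + y} ->
  {morph v : x y / op_mul o x y >-> x * y} ->
  {morph v : x / op_opp o x >-> - x} ->
  is_comring o.
Proof.
move=> v_inj v0 v1 vD vM vN.
split=> [x y z|x y|x|x|x y z|x y|x|x y z]; apply: v_inj; rewrite !(vD, vM, vN, v0, v1).
- exact: addrA.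
- exact: addrC.
- exact: add0r.
- exact: addNr.
- exact: mulrA.
- exact: mulrC.
- exact: mul1r.
- exact: mulrDl.
Qed.

Lemma int_of_sadd u v :
  int_of_signed (sadd u v) = int_of_signed u + int_of_signed v.
Proof. by rewrite /int_of_signed !nat_of_naddE !PoszD opprD addrACA. Qed.

Lemma int_of_smul u v :
  int_of_signed (smul u v) = int_of_signed u * int_of_signed v.
Proof.
rewrite /int_of_signed !nat_of_naddE !nat_of_nmulE !PoszD !PoszM.
by rewrite mulrBl !mulrBr opprB opprD addrACA.
Qed.

Lemma int_of_sopp u : int_of_signed (sopp u) = - int_of_signed u.
Proof. by rewrite /int_of_signed opprB. Qed.

Lemma int_of_signed_of d : int_of_signed (signed_of d) = (nat_of_Nd d)%:Z.
Proof. by rewrite /int_of_signed subr0. Qed.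

Definition signed_of_int (z : int) : signed_orbit :=
  match z with
  | Posz n => (Nd_of_nat n, Nd0)
  | Negz n => (Nd0, Nd_of_nat n.+1)
  end.

Lemma signed_of_intK : cancel signed_of_int int_of_signed.
Proof.
case=> n; rewrite /int_of_signed [X in Posz X - _]/= [X in _ - Posz X]/=.
  by rewrite Nd_of_natK subr0.
by rewrite sub0r NegzE Nd_of_natK.
Qed.

Definition int_of_Zd (z : Zd) : int := int_of_signed (repr z).

Lemma int_of_classZ u : int_of_Zd (classZ u) = int_of_signed u.
Proof. by apply/eqP; rewrite -balancedE; apply/(eqquotP Zd); rewrite reprK. Qed.

Lemma int_of_Zd_inj : injective int_of_Zd.
Proof.
move=> x y /eqP; rewrite -balancedE => /(eqquotP Zd).
by rewrite !reprK.
Qed.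

Lemma int_of_add_Z : {morph int_of_Zd : x y / add_Z x y >-> x + y}.
Proof. by move=> x y; rewrite /add_Z -lock int_of_classZ int_of_sadd. Qed.

Lemma int_of_mul_Z : {morph int_of_Zd : x y / mul_Z x y >-> x * y}.
Proof. by move=> x y; rewrite /mul_Z -lock int_of_classZ int_of_smul. Qed.

Lemma int_of_opp_Z : {morph int_of_Zd : x / opp_Z x >-> - x}.
Proof. by move=> x; rewrite /opp_Z -lock int_of_classZ int_of_sopp. Qed.

Lemma int_of_zero_Z : int_of_Zd zero_Z = 0.
Proof. by rewrite int_of_classZ. Qed.

Lemma int_of_one_Z : int_of_Zd one_Z = 1.
Proof. by rewrite int_of_classZ. Qed.

Lemma int_of_Nd_to_Zd a : int_of_Zd (Nd_to_Zd a) = (nat_of_Nd a)%:Z.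
Proof. by rewrite int_of_classZ -int_of_signed_of. Qed.

Lemma Zd_induced : induced_Z.
Proof.
split=> [u v|u v|u]; apply: int_of_Zd_inj; rewrite int_of_classZ.
- by rewrite int_of_add_Z !int_of_classZ int_of_sadd.
- by rewrite int_of_mul_Z !int_of_classZ int_of_smul.
- by rewrite int_of_opp_Z !int_of_classZ int_of_sopp.
Qed.

Lemma Zd_domain : is_domain Zd_ops.
Proof.
split.
- apply: (comring_of_embedding int_of_Zd_inj).
  + exact: int_of_zero_Z.
  + exact: int_of_one_Z.
  + exact: int_of_add_Z.
  + exact: int_of_mul_Z.
  + exact: int_of_opp_Z.
- by move/(congr1 int_of_Zd); rewrite int_of_one_Z int_of_zero_Z.
- move=> x y /(congr1 int_of_Zd)/eqP.
  rewrite int_of_mul_Z int_of_zero_Z mulf_eq0 -int_of_zero_Z.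
  by case/orP=> /eqP/int_of_Zd_inj; [left | right].
Qed.

Lemma Zd_group : is_group zero_Z add_Z opp_Z.
Proof. by case: (dom_ring Zd_domain) => ? ? ? ? _ _ _ _; split. Qed.

Lemma Zd_difference (z : Zd) :
  {pn : Nd * Nd | add_Z z (Nd_to_Zd pn.2) = Nd_to_Zd pn.1}.
Proof.
exists (repr z); apply: int_of_Zd_inj.
by rewrite int_of_add_Z !int_of_Nd_to_Zd {1}/int_of_Zd subrK.
Qed.

Lemma Zd_group_completion :
  is_group_completion Nd0 nadd zero_Z add_Z opp_Z Nd_to_Zd.
Proof.
apply: group_completion_of_differences.
- exact: Nd_comm_monoid.
- exact: Zd_group.
- exact: cr_addC (dom_ring Zd_domain).
- split=> // a b; apply: int_of_Zd_inj.
  by rewrite int_of_add_Z !int_of_Nd_to_Zd nat_of_naddE PoszD.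
- move=> a b /(congr1 int_of_Zd); rewrite !int_of_Nd_to_Zd.
  by case=> /nat_of_Nd_inj.
- exact: Zd_difference.
Qed.

(** * Rational values, and the field of fractions *)

Definition rat_of_ratio (r : ratio_orbit) : rat :=
  (int_of_signed (num r))%:~R / (nat_of_Nd (den r))%:R.

Lemma nat_of_Nd_neq0 d : d != Nd0 -> (nat_of_Nd d)%:R != 0 :> rat.
Proof. by rewrite Num.Theory.pnatr_eq0 -(inj_eq nat_of_Nd_inj). Qed.

Lemma den_rat_neq0 r : (nat_of_Nd (den r))%:R != 0 :> rat.
Proof. exact/nat_of_Nd_neq0/den_neq0. Qed.

Lemma cross_equal_rat r s : cross_equal r s = (rat_of_ratio r == rat_of_ratio s).
Proof.
rewrite cross_equalE eqr_div ?den_rat_neq0 //.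
by rewrite !pmulrn -!intrM eqr_int.
Qed.

Lemma rat_of_radd r s : rat_of_ratio (radd r s) = rat_of_ratio r + rat_of_ratio s.
Proof.
rewrite /rat_of_ratio [num _]/= [den _]/= nat_of_nmulE int_of_sadd.
rewrite !int_of_smul_signed_of addf_div ?den_rat_neq0 //.
by rewrite natrM intrD !intrM.
Qed.

Lemma rat_of_rmul r s : rat_of_ratio (rmul r s) = rat_of_ratio r * rat_of_ratio s.
Proof.
rewrite /rat_of_ratio [num _]/= [den _]/= nat_of_nmulE int_of_smul.
by rewrite mulf_div natrM intrM.
Qed.

Lemma rat_of_ropp r : rat_of_ratio (ropp r) = - rat_of_ratio r.
Proof. by rewrite /rat_of_ratio [num _]/= [den _]/= int_of_sopp mulrNz mulNr. Qed.

Lemma rat_of_integral u : rat_of_ratio (mk_ratio u Nd1_neq0) = (int_of_signed u)%:~R.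
Proof. by rewrite /rat_of_ratio divr1. Qed.

Definition rat_of_Qd (q : Qd) : rat := rat_of_ratio (repr q).

Lemma rat_of_classQ r : rat_of_Qd (classQ r) = rat_of_ratio r.
Proof. by apply/eqP; rewrite -cross_equal_rat; apply/(eqquotP Qd); rewrite reprK. Qed.

Lemma rat_of_Qd_inj : injective rat_of_Qd.
Proof.
move=> x y /eqP; rewrite -cross_equal_rat => /(eqquotP Qd).
by rewrite !reprK.
Qed.

Lemma rat_of_add_Q : {morph rat_of_Qd : x y / add_Q x y >-> x + y}.
Proof. by move=> x y; rewrite /add_Q -lock rat_of_classQ rat_of_radd. Qed.

Lemma rat_of_mul_Q : {morph rat_of_Qd : x y / mul_Q x y >-> x * y}.
Proof. by move=> x y; rewrite /mul_Q -lock rat_of_classQ rat_of_rmul. Qed.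

Lemma rat_of_opp_Q : {morph rat_of_Qd : x / opp_Q x >-> - x}.
Proof. by move=> x; rewrite /opp_Q -lock rat_of_classQ rat_of_ropp. Qed.

Lemma rat_of_zero_Q : rat_of_Qd zero_Q = 0.
Proof. by rewrite rat_of_classQ rat_of_integral. Qed.

Lemma rat_of_one_Q : rat_of_Qd one_Q = 1.
Proof. by rewrite rat_of_classQ rat_of_integral. Qed.

Lemma rat_of_Zd_to_Qd z : rat_of_Qd (Zd_to_Qd z) = (int_of_Zd z)%:~R.
Proof. by rewrite rat_of_classQ rat_of_integral. Qed.

Lemma Qd_induced : induced_Q.
Proof.
split=> [r s|r s|r|u]; apply: rat_of_Qd_inj.
- by rewrite rat_of_add_Q !rat_of_classQ rat_of_radd.
- by rewrite rat_of_mul_Q !rat_of_classQ rat_of_rmul.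
- by rewrite rat_of_opp_Q !rat_of_classQ rat_of_ropp.
- by rewrite rat_of_Zd_to_Qd int_of_classZ rat_of_classQ rat_of_integral.
Qed.

Lemma denq_orbit_neq0 (x : rat) : Nd_of_nat `|denq x| != Nd0.
Proof. by rewrite -(inj_eq nat_of_Nd_inj) Nd_of_natK absz_eq0 denq_neq0. Qed.

Definition Qd_of_rat (x : rat) : Qd :=
  classQ (mk_ratio (signed_of_int (numq x)) (denq_orbit_neq0 x)).

Lemma Qd_of_ratK : cancel Qd_of_rat rat_of_Qd.
Proof.
move=> x; rewrite rat_of_classQ /rat_of_ratio [num _]/= [den _]/=.
rewrite signed_of_intK Nd_of_natK -[RHS]divq_num_den; congr (_ / _).
by rewrite pmulrn absz_denq.
Qed.

Lemma Qd_field : is_field Qd_ops.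
Proof.
split.
- apply: (comring_of_embedding rat_of_Qd_inj).
  + exact: rat_of_zero_Q.
  + exact: rat_of_one_Q.
  + exact: rat_of_add_Q.
  + exact: rat_of_mul_Q.
  + exact: rat_of_opp_Q.
- by move/(congr1 rat_of_Qd); rewrite rat_of_one_Q rat_of_zero_Q.
- move=> q nz_q; exists (Qd_of_rat (rat_of_Qd q)^-1); apply: rat_of_Qd_inj.
  rewrite rat_of_mul_Q Qd_of_ratK rat_of_one_Q divff //.
  by apply/eqP; rewrite -rat_of_zero_Q => /rat_of_Qd_inj.
Qed.

Lemma Qd_fraction (q : Qd) : {ab : Zd * Zd |
  ab.2 <> zero_Z /\ mul_Q q (Zd_to_Qd ab.2) = Zd_to_Qd ab.1}.
Proof.
exists (classZ (num (repr q)), Nd_to_Zd (den (repr q))); split=> /=.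
  move/(congr1 int_of_Zd); rewrite int_of_Nd_to_Zd int_of_zero_Z => -[d0].
  by have := den_rat_neq0 (repr q); rewrite d0 eqxx.
apply: rat_of_Qd_inj.
rewrite rat_of_mul_Q !rat_of_Zd_to_Qd int_of_Nd_to_Zd int_of_classZ.
by rewrite /rat_of_Qd /rat_of_ratio divfK ?den_rat_neq0.
Qed.

Lemma Qd_fraction_field : is_fraction_field Zd_ops Qd_ops Zd_to_Qd.
Proof.
apply: fraction_field_of_fractions.
- exact: Zd_domain.
- exact: Qd_field.
- split=> [|x y|x y]; apply: rat_of_Qd_inj; rewrite rat_of_Zd_to_Qd.
  + by rewrite int_of_one_Z rat_of_one_Q.
  + by rewrite int_of_add_Z rat_of_add_Q !rat_of_Zd_to_Qd intrD.
  + by rewrite int_of_mul_Z rat_of_mul_Q !rat_of_Zd_to_Qd intrM.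
- move=> x y /(congr1 rat_of_Qd); rewrite !rat_of_Zd_to_Qd.
  by move/intr_inj/int_of_Zd_inj.
- exact: Qd_fraction.
Qed.

End Values.

Theorem theorem1p7 :
  ((is_nno Nd0 NdS
    * (induced_Z
       * is_group_completion Nd0 nadd zero_Z add_Z opp_Z Nd_to_Zd)
    * (induced_Q
       * is_fraction_field Zd_ops Qd_ops Zd_to_Qd))
   * (delta_encodable nat * delta_encodable int * delta_encodable rat))%type.
Proof.
split; last by do !split; exact: delta_encodable_countable.
split; first split.
- exact: Nd_is_nno.
- by split; [exact: Zd_induced | exact: Zd_group_completion].
- by split; [exact: Qd_induced | exact: Qd_fraction_field].
Qed.
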